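(* Let $\omega$ be a Weierstrass representation of a Riemann surface $M$, and let $(S,u,v)$ be the corresponding spinor representation. Then the integrability condition $\operatorname{Re}(d\omega)=0$ on $\omega$ is equivalent to the following system of equations between sections of $S^{*1,0}\otimes S^{*0,1}$: $$\begin{cases} v\otimes Dv=-D\overline{u}\otimes\overline{u},\\ u\otimes Dv+v\otimes Du=D\overline{v}\otimes\overline{u}+D\overline{u}\otimes\overline{v}.\end{cases}$$
   Context: A Weierstrass representation of $M$ is a nowhere vanishing smooth $\mathbb{C}^3$-valued $(1,0)$-form $\omega=(\omega_1,\omega_2,\omega_3)$ on $M$ with $\omega_1^2+\omega_2^2+\omega_3^2=0$. For a complex line bundle $E$, $E^{*1,0}$ and $E^{*0,1}$ denote the bundles of $\mathbb{C}$-linear and $\mathbb{C}$-antilinear functionals on $E$; complex conjugation interchanges them. A square root of $TM$ is a smooth complex line bundle $S$ with a smooth surjective bundle map $S\to TM$, $s\mapsto s^2$, complex-quadratic on fibers; it has a unique holomorphic structure making this map holomorphic. It induces isomorphisms $S\otimes S\cong TM$, $S^{*1,0}\otimes S^{*1,0}\cong T^{*1,0}M$, $S^{*0,1}\otimes S^{*0,1}\cong T^{*0,1}M$; for sections $\xi,\xi'$ of $S^{*1,0}$, $\xi\xi'$ is the $(1,0)$-form with $(\xi\xi')(s^2)=\xi(s)\xi'(s)$, and $\xi^2=\xi\xi$. The spinor representation corresponding to $\omega$ is the square root $S$ of $TM$ (unique up to equivalence) together with smooth sections $u,v$ of $S^{*1,0}$ without common zeros (unique up to equivalence) such that $\omega=(u^2-v^2,\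 i(u^2+v^2),\ 2uv)$. $M$ carries the Hermitian metric $h$ with $h(w,w)=\|\omega(w)\|^2$ for $w\in TM$ ($\|\cdot\|$ the standard Hermitian norm on $\mathbb{C}^3$), and $S$ carries the Hermitian metric $\sqrt h$ with $\sqrt h(s,s)=\sqrt{h(s^2,s^2)}$. In a local holomorphic coordinate $z=x+iy$ write $\omega=\widetilde\omega\,dz$; let $\sqrt{dz}$ be a local section of $S^{*1,0}$ with $(\sqrt{dz})^2=dz$, and $\sqrt{d\overline z}=\overline{\sqrt{dz}}$. Then $\sqrt h=\|\widetilde\omega\|\sqrt{dz}\otimes\sqrt{d\overline z}$. The Dirac operator $D$ (mapping sections of $S^{*1,0}$ to sections of $S^{*0,1}$ and vice versa) is $$D(f\sqrt{dz})=\frac{f_{\overline z}}{\|\widetilde\omega\|}\sqrt{d\overline z},\qquad D(f\sqrt{d\overline z})=\frac{f_z}{\|\widetilde\omega\|}\sqrt{dz}$$ (invariantly: the Dolbeault operator $\overline\partial$ on $S^{*1,0}$, resp. $\partial$ on $S^{*0,1}$, followed by the inverse of the isomorphism $S^{*0,1}\cong T^{*0,1}M\otimes S^{*1,0}$, resp. $S^{*1,0}\cong T^{*1,0}M\otimes S^{*0,1}$, given by multiplication by $\sqrt h$). $D$ commutes with complex conjugation. Here $D\overline u\otimes\overline u$ etc. are sections of $S^{*1,0}\otimes S^{*0,1}$. *)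

(* Defs.v *)
From HB Require Import structures.
From mathcomp Require Import all_boot all_order all_algebra.
From mathcomp Require Import complex.
From mathcomp Require Import all_classical all_reals all_analysis.

Set Implicit Arguments.
Unset Strict Implicit.
Unset Printing Implicit Defensive.

Import Order.TTheory GRing.Theory Num.Theory numFieldNormedType.Exports.

Local Open Scope classical_set_scope.
Local Open Scope ring_scope.
Local Open Scope complex_scope.

(* The topology (and complex differentiability) on [R[i]] is the one of the
   normed module [R[i]^o]; [complex.Re] and [complex.Im] take values in [R]. *)

Section PlaneCalculus.
Context {R : realType}.
Implicit Types (F : R[i] -> R[i]) (z w : R[i]) (V : set R[i]).

(* Real directional derivatives: [rderive 1 F] and [rderive 'i F] are the
   partial derivatives of [F] in x and y, where z = x + iy. *)
Definition rderivable w F z : Prop :=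
  derivable (fun t : R => complex.Re (F (z + t%:C * w))) 0 1 /\
  derivable (fun t : R => complex.Im (F (z + t%:C * w))) 0 1.

Definition rderive w F z : R[i] :=
  ('D_1 (fun t : R => complex.Re (F (z + t%:C * w))) 0)
  +i* ('D_1 (fun t : R => complex.Im (F (z + t%:C * w))) 0).

Definition d_z F z : R[i] := (rderive 1 F z - 'i * rderive 'i F z) / 2.
Definition d_zbar F z : R[i] := (rderive 1 F z + 'i * rderive 'i F z) / 2.

Fixpoint Ck (n : nat) V F : Prop :=
  (forall z, V z -> {for z, continuous (F : R[i]^o -> R[i]^o)}) /\
  if n is m.+1 then
    [/\ forall z, V z -> rderivable 1 F z /\ rderivable 'i F z,
        Ck m V (rderive 1 F) & Ck m V (rderive 'i F)]
  else True.

(* Only meaningful for [V] open. *)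
Definition smooth_on V F : Prop := forall n, Ck n V F.

End PlaneCalculus.

(* [coord] and [coord_inv] are total functions; only their restrictions to the
   domain, resp. to its image, matter. *)
Record chart (R : realType) (M : topologicalType) := Chart {
  chart_dom : set M;
  coord : M -> R[i]^o;
  coord_inv : R[i]^o -> M;
  chart_dom_open : open chart_dom;
  chart_im_open : open (coord @` chart_dom);
  coordK : forall p, chart_dom p -> coord_inv (coord p) = p;
  coord_continuous : forall p, chart_dom p -> {for p, continuous coord};
  coord_inv_continuous : forall z, (coord @` chart_dom) z ->
    {for z, continuous coord_inv} }.

Definition transition (R : realType) (M : topologicalType) (c c' : chart R M) :
  R[i]^o -> R[i]^o := fun z => coord c' (coord_inv c z).

Record riemannSurface (R : realType) := RiemannSurface {
  space :> topologicalType;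
  space_hausdorff : hausdorff_space space;
  atlas : set (chart R space);
  atlas_cover : forall p, exists c, atlas c /\ chart_dom c p;
  atlas_holomorphic : forall c c' p, atlas c -> atlas c' ->
    chart_dom c p -> chart_dom c' p ->
    derivable (transition c c') (coord c p) 1 }.

Lemma derive_comp1 (K : numFieldType) (f g : K^o -> K^o) (x : K^o) :
  derivable f x 1 -> derivable g (f x) 1 ->
  'D_1 (g \o f) x = 'D_1 g (f x) * 'D_1 f x.
Proof.
move=> /derivable1_diffP df /derivable1_diffP dg.
rewrite (deriveE (1 : K^o) (differentiable_comp df dg)) (deriveE (1 : K^o) df) (deriveE (1 : K^o) dg).
rewrite (diff_comp df dg) /=; set y := 'd f x _.
have {1}-> : y = y *: (1 : K^o) by rewrite [RHS]mulr1.
by rewrite linearZ mulrC.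
Qed.

Section RiemannSurface.
Context {R : realType} {M : riemannSurface R}.
Implicit Types (p q : M) (c : chart R M) (U : set M).

Definition chart_near p c : Prop := atlas c /\ chart_dom c p.

Definition chart_at p : chart R M := sval (cid (atlas_cover p)).

Definition smooth_fun U (f : M -> R[i]) : Prop := forall c, atlas c ->
  smooth_on (coord c @` (U `&` chart_dom c)) (f \o coord_inv c).

(* A tangent vector at [p] is the family of its components in all charts
   around [p], related by the derivatives of the coordinate changes; the
   components in the other charts are set to 0. This is the real tangent
   space with its complex structure: in the chart with coordinate z = x + iy,
   the component a + ib stands for the vector a d/dx + b d/dy. *)

Definition tangent_pred p : {pred chart R M -> R[i]^o} := fun w => `[<
  (forall c, ~ chart_near p c -> w c = 0) /\
  (forall c c', chart_near p c -> chart_near p c' ->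
     w c' = 'D_1 (transition c c') (coord c p) * w c) >].

Lemma tangent_submod p : submod_closed (tangent_pred p).
Proof.
split=> [|a x y]; first by apply/asboolP; split=> // c c' _ _; rewrite mulr0.
move=> /asboolP[x0 xD] /asboolP[y0 yD]; apply/asboolP; split=> [c nc|c c' hc hc'].
  by rewrite /= !fctE x0 // y0 // scaler0 addr0.
by rewrite !fctE (xD c c') // (yD c c') // mulrDr scalerAr.
Qed.
HB.instance Definition _ p :=
  GRing.isSubmodClosed.Build R[i] _ (tangent_pred p) (tangent_submod p).

Record tangent p := Tangent {
  component :> chart R M -> R[i]^o;
  _ : component \in tangent_pred p }.
HB.instance Definition _ p := [isSub for @component p].
HB.instance Definition _ p := [Choice of tangent p by <:].
HB.instance Definition _ p := [SubChoice_isSubLmodule of tangent p by <:].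


Lemma transition_comp p c c' c'' : chart_near p c -> chart_near p c' ->
  chart_near p c'' ->
  'D_1 (transition c c'') (coord c p) =
  'D_1 (transition c' c'') (coord c' p) * 'D_1 (transition c c') (coord c p).
Proof.
move=> [ac cp] [ac' c'p] [ac'' c''p].
have E : transition c c' (coord c p) = coord c' p by rewrite /transition coordK.
have := @derive_comp1 R[i] (transition c c') (transition c' c'') (coord c p).
rewrite E => <-; try exact: atlas_holomorphic.
apply: near_eq_derive.
have Ic : (coord c @` chart_dom c) (coord c p) by exists p.
have : \forall z \near coord c p, chart_dom c' (coord_inv c z).
  apply: (coord_inv_continuous Ic); rewrite coordK //.
  by apply: open_nbhs_nbhs; split=> //; exact: chart_dom_open.
by apply: filterS => z hz; rewrite /= /transition coordK.
Qed.

Fact coord_vector_subproof c p : (fun c' => if `[< chart_near p c /\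
    chart_near p c' >] then 'D_1 (transition c c') (coord c p) else 0)
  \in tangent_pred p.
Proof.
apply/asboolP; split=> [c' nc'|c' c'' hc' hc'']; first by case: asboolP => // -[].
case: asboolP => [[hc _]|h1]; case: asboolP => [[hc1 _]|h2]; rewrite ?mulr0 //.
- exact: transition_comp.
- by case: h2; split.
- by case: h1; split.
Qed.

(* The coordinate vector d/dz of the chart [c] (i.e. d/dx, with 'i d/dz being
   d/dy); by convention it is 0 outside the domain of [c]. The differential
   dz of the coordinate is [w |-> w c]. *)
Definition coord_vector c p : tangent p := Tangent (coord_vector_subproof c p).

Definition smooth_field U (X : forall p, tangent p) : Prop :=
  forall c, atlas c -> smooth_fun (U `&` chart_dom c) (fun p => X p c).

(* Complex-valued 1-forms; the value of a 1-form at a point is meant to be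
   R-linear. *)
Definition one_form := forall p, tangent p -> R[i].

Definition smooth_form10 (alpha : one_form) : Prop :=
  (forall p, scalar (alpha p)) /\
  (forall c, atlas c ->
     smooth_fun (chart_dom c) (fun p => alpha p (coord_vector c p))).

(* If alpha = a dx + b dy then d alpha = (b_x - a_y) dx /\ dy. The value does
   not depend on the coordinate z = x + iy, here the one of [chart_at p]. *)
Definition ext_deriv (alpha : one_form) p (w1 w2 : tangent p) : R[i] :=
  let c := chart_at p in
  let a q := alpha q (coord_vector c q) in
  let b q := alpha q ('i *: coord_vector c q) in
  (rderive 1 (b \o coord_inv c) (coord c p)
   - rderive 'i (a \o coord_inv c) (coord c p))
  * (complex.Re (w1 c) * complex.Im (w2 c)
     - complex.Im (w1 c) * complex.Re (w2 c))%:C.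

Definition weierstrass_representation (omega : 'I_3 -> one_form) : Prop :=
  [/\ forall k, smooth_form10 (omega k),
      forall p, exists k w, omega k p w != 0 &
      forall p w, \sum_(k < 3) omega k p w ^+ 2 = 0].

(* The norm of [omega p w] in C^3: the norm of [w] for the metric h. It is a
   nonnegative real element of [R[i]]. *)
Definition form_norm (omega : 'I_3 -> one_form) p (w : tangent p) : R[i] :=
  sqrtC (\sum_(k < 3) `|omega k p w| ^+ 2).

End RiemannSurface.
Arguments one_form {R} M.

(* A smooth complex line bundle, presented by its fibers and a family of
   local frames that cover the base and have smooth transition functions. *)
Record lineBundle (R : realType) (M : riemannSurface R) := LineBundle {
  fiber :> M -> lmodType R[i];
  frame_index : Type;
  frame_dom : frame_index -> set M;
  frame : frame_index -> forall p, fiber p;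
  frame_dom_open : forall j, open (frame_dom j);
  frame_cover : forall p, exists j, frame_dom j p;
  frame_neq0 : forall j p, frame_dom j p -> frame j p != 0;
  frame_span : forall j p, frame_dom j p ->
    forall s : fiber p, exists a, s = a *: frame j p;
  frame_smooth : forall j l, exists g : M -> R[i],
    smooth_fun (frame_dom j `&` frame_dom l) g /\
    forall p, frame_dom j p -> frame_dom l p -> frame l p = g p *: frame j p }.

Definition smooth_section (R : realType) (M : riemannSurface R)
    (E : lineBundle M) (U : set M) (s : forall p, E p) : Prop :=
  forall j, exists f : M -> R[i], smooth_fun (U `&` frame_dom j) f /\
    forall p, U p -> frame_dom j p -> s p = f p *: frame j p.

Definition complex_quadratic (R : realType) (E F : lmodType R[i]) (Q : E -> F) :=
  (forall a s, Q (a *: s) = a ^+ 2 *: Q s) /\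
  (forall s, linear (fun t => Q (s + t) - Q s - Q t)).

(* As the map is quadratic on the fibers, it is smooth as a map of total spaces
   if and only if it sends smooth local sections to smooth local sections. *)
Record squareRoot (R : realType) (M : riemannSurface R) := SquareRoot {
  root_bundle :> lineBundle M;
  square : forall p, root_bundle p -> tangent p;
  square_quadratic : forall p, complex_quadratic (@square p);
  square_surjective : forall p w, exists s, @square p s = w;
  square_smooth : forall (U : set M) (s : forall p, root_bundle p), open U ->
    smooth_section U s -> smooth_field U (fun p => square (s p)) }.

Section Spinor.
Context {R : realType} {M : riemannSurface R}.
Variables (omega : 'I_3 -> one_form M) (S : squareRoot M).

(* Common type of the sections of S^{*1,0} (C-linear at each point) and of
   S^{*0,1} (C-antilinear at each point). *)
Definition cosection := forall p, S p -> R[i].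
Implicit Types (xi eta : cosection) (p : M) (U : set M).

Definition conj_cosection xi : cosection := fun p s => (xi p s)^*.

(* [xi p (frame j p)] is the coordinate of [xi p] in the dual frame. *)
Definition smooth_section10 U xi : Prop :=
  (forall p, U p -> scalar (xi p)) /\
  (forall j, smooth_fun (U `&` frame_dom j) (fun p => xi p (frame j p))).

(* The products of cosections are determined by their values on squares: for
   instance u^2 is the form whose value at [square s] is [u p s ^+ 2]. *)
Definition spinor_representation (u v : cosection) : Prop :=
  [/\ smooth_section10 setT u /\ smooth_section10 setT v,
      forall p, exists s, (u p s != 0) || (v p s != 0) &
      forall p (s : S p),
        [/\ omega 0 (square s) = u p s ^+ 2 - v p s ^+ 2,
            omega 1 (square s) = 'i * (u p s ^+ 2 + v p s ^+ 2) &
            omega 2 (square s) = 2 * u p s * v p s]].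

Definition is_sqrt_dz (c : chart R M) U (sigma : cosection) : Prop :=
  [/\ U `<=` chart_dom c, smooth_section10 U sigma &
      forall p (s : S p), U p -> sigma p s ^+ 2 = square s c].

(* A square root of dz around [p], for the coordinate z of [chart_at p]. It
   exists and is unique up to sign, and the sign does not affect [dirac10] and
   [dirac01] below. *)
Definition sqrt_dz p : cosection := xget (fun _ _ => 0)
  [set sigma | exists U, [/\ open U, U p & is_sqrt_dz (chart_at p) U sigma]].

(* The function f such that xi = f sigma (where sigma does not vanish) *)
Definition coefficient xi sigma (q : M) : R[i] :=
  xget 0 [set a | forall s, xi q s = a * sigma q s].

(* The Dirac operator from S^{*1,0} to S^{*0,1}, and from S^{*0,1} to S^{*1,0}.
   Their values do not depend on the coordinate z, here the one of
   [chart_at p]. *)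
Definition dirac10 xi : cosection := fun p s =>
  let c := chart_at p in
  let sigma := sqrt_dz p in
  d_zbar (coefficient xi sigma \o coord_inv c) (coord c p)
  / form_norm omega (coord_vector c p) * conj_cosection sigma s.

Definition dirac01 eta : cosection := fun p s =>
  let c := chart_at p in
  let sigma := sqrt_dz p in
  d_z (coefficient eta (conj_cosection sigma) \o coord_inv c) (coord c p)
  / form_norm omega (coord_vector c p) * sigma p s.

(* The fiber of S^{*1,0} (x) S^{*0,1} at [p] is identified with the space of
   sesquilinear forms on the fiber of [S] at [p]. *)
Definition tensor xi eta p : S p -> S p -> R[i] :=
  fun s t => xi p s * eta p t.

End Spinor.
Arguments conj_cosection {R M S} xi p _.
Arguments dirac10 {R M} omega {S} xi p _.
Arguments dirac01 {R M} omega {S} eta p _.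
Arguments tensor {R M S} xi eta p _ _.

(* Main.v *)
(** Near [p] write the form as [f_k dz], [u = a sqrt(dz)] and [v = b sqrt(dz)], so
    that [f = (a^2 - b^2, i (a^2 + b^2), 2 a b)]. Since [d (f_k dz)] is
    [2i (f_k)_zbar dx /\ dy], the integrability condition says that each
    [(f_k)_zbar] is real. With [A = a a_zbar] and [B = b b_zbar] the first two
    components say that [A - B] is real and [A + B] imaginary, that is
    [B = - conj A], and the third one that [a b_zbar + b a_zbar] is real. In the
    frame [sqrt(dz) (x) sqrt(dzbar)] these are the two Dirac equations, because
    [(conj a)_z = conj (a_zbar)]. The local section [sqrt(dz)] is the dual of a
    frame [e] of [S] multiplied by a smooth square root of [dz (e^2)]. *)

Require Import Defs.
From mathcomp Require Import all_boot all_order all_algebra.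
From mathcomp Require Import complex.
From mathcomp Require Import all_classical all_reals all_analysis.
From mathcomp Require Import ring lra.
Import Order.TTheory GRing.Theory Num.Theory numFieldNormedType.Exports.
Local Open Scope classical_set_scope.
Local Open Scope ring_scope.
Local Open Scope complex_scope.

Local Notation coord := Defs.coord.

(** * Partial derivatives of complex-valued functions *)

Section Calculus.
Context {R : realType}.
Implicit Types (F G : R[i] -> R[i]) (w z d e : R[i]) (V : set R[i]^o).

(** [rderive] is total, so its value alone does not say that the derivative exists; this relation
    records existence and value together, which lets the rules below compose. *)
Definition has_rderive w F z d : Prop :=
  is_derive (0 : R) (1 : R) (fun t : R => complex.Re (F (z + t%:C * w)))
    (complex.Re d) /\
  is_derive (0 : R) (1 : R) (fun t : R => complex.Im (F (z + t%:C * w)))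
    (complex.Im d).

Lemma rderivableP w F z :
  rderivable w F z <-> has_rderive w F z (rderive w F z).
Proof.
split=> [dF|[dR dI]].
  by split; [exact: DeriveDef dF.1 erefl|exact: DeriveDef dF.2 erefl].
by split; [case: dR => + _|case: dI => + _]; apply.
Qed.

Lemma has_rderive_val {w F z d} : has_rderive w F z d -> rderive w F z = d.
Proof. by case: d => a b [[_ /= dR] [_ /= dI]]; rewrite /rderive dR dI. Qed.

Lemma has_rderive_able {w F z d} : has_rderive w F z d -> rderivable w F z.
Proof. by move=> dF; apply/rderivableP; rewrite (has_rderive_val dF). Qed.

Lemma Re_mulc (a b : R[i]) : complex.Re (a * b) =
  complex.Re a * complex.Re b - complex.Im a * complex.Im b.
Proof. by case: a b => [? ?] [? ?]. Qed.

Lemma Im_mulc (a b : R[i]) : complex.Im (a * b) =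
  complex.Re a * complex.Im b + complex.Im a * complex.Re b.
Proof. by case: a b => [? ?] [? ?]. Qed.

Lemma Re_addc (a b : R[i]) : complex.Re (a + b) = complex.Re a + complex.Re b.
Proof. by case: a b => [? ?] [? ?]. Qed.

Lemma Im_addc (a b : R[i]) : complex.Im (a + b) = complex.Im a + complex.Im b.
Proof. by case: a b => [? ?] [? ?]. Qed.

Lemma rline0 z w : z + (0 : R)%:C * w = z.
Proof. by rewrite mul0r addr0. Qed.

Lemma has_rderive_cst w z a : has_rderive w (fun=> a) z 0.
Proof. by split; exact: is_derive_cst. Qed.

Lemma has_rderiveD w F G z d e : has_rderive w F z d -> has_rderive w G z e ->
  has_rderive w (fun x => F x + G x) z (d + e).
Proof.
move=> [FR FI] [GR GI]; split.
- rewrite Re_addc; under [X in is_derive _ _ X]funext do rewrite Re_addc.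
  exact: is_deriveD.
- rewrite Im_addc; under [X in is_derive _ _ X]funext do rewrite Im_addc.
  exact: is_deriveD.
Qed.

Lemma has_rderiveM w F G z d e : has_rderive w F z d -> has_rderive w G z e ->
  has_rderive w (fun x => F x * G x) z (d * G z + F z * e).
Proof.
move=> [FR FI] [GR GI]; split.
- under [X in is_derive _ _ X]funext do rewrite Re_mulc.
  case: (is_deriveB (is_deriveM FR GR) (is_deriveM FI GI)) => D E.
  split; [exact: D|apply: (etrans E)].
  by rewrite !rline0 Re_addc !Re_mulc /GRing.scale /=; ring.
- under [X in is_derive _ _ X]funext do rewrite Im_mulc.
  case: (is_deriveD (is_deriveM FR GI) (is_deriveM FI GR)) => D E.
  split; [exact: D|apply: (etrans E)].
  by rewrite !rline0 Im_addc !Im_mulc /GRing.scale /=; ring.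
Qed.

Lemma has_rderive_conj w F z d :
  has_rderive w F z d -> has_rderive w (fun x => (F x)^*) z d^*.
Proof.
have RJ (x : R[i]) : complex.Re x^* = complex.Re x by case: x.
have IJ (x : R[i]) : complex.Im x^* = - complex.Im x by case: x.
move=> [FR FI]; split.
- by rewrite RJ; under [X in is_derive _ _ X]funext do rewrite RJ.
- rewrite IJ; under [X in is_derive _ _ X]funext do rewrite IJ.
  exact: is_deriveN.
Qed.

(** This lets a property that holds near [z] in the plane be used near 0 in the real parameter of a
    directional derivative. *)
Lemma rline_cvg z w : (fun t : R => z + t%:C * w : R[i]^o) @ (0 : R) --> (z : R[i]^o).
Proof.
apply/cvgrPdist_lt => /= e e0.
have Ree0 : 0 < complex.Re e by move: e0; rewrite ltcE => /andP[].
(* In the order of [R[i]] a positive element is real, so the estimate can be carried out in [R]. *)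
have eE : e = (complex.Re e)%:C.
  by case: e e0 {Ree0} => a b; rewrite ltcE /= => /andP[/eqP-> _].
(* The added 1 keeps the divisor positive when [w] is 0. *)
have k0 : 0 < 1 + complex.Re `|w|.
  have : 0 <= `|w| by [].
  by rewrite lecE /= => /andP[_ /= h]; rewrite ltr_pwDl.
near=> t.
rewrite opprD addrA subrr add0r normrN normrM.
have -> : `|t%:C : R[i]| = `|t|%:C.
  by rewrite normc_def /= expr0n addr0 sqrtr_sqr.
rewrite eE normc_def -rmorphM ltcR.
apply: (@le_lt_trans _ _ (`|t| * (1 + complex.Re `|w|))).
  by apply: ler_wpM2l => //; rewrite normc_def /= lerDr.
rewrite -ltr_pdivlMr //.
near: t.
by apply: (@nbhs0_lt R R (complex.Re e / (1 + complex.Re `|w|))); exact: divr_gt0.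
Unshelve. all: by end_near.
Qed.

Lemma near_rline z w (P : set R[i]^o) : nbhs (z : R[i]^o) P ->
  \forall t \near (0 : R), P (z + t%:C * w).
Proof. exact: rline_cvg. Qed.

Lemma has_rderive_near w F G z d : (\forall x \near (z : R[i]^o), F x = G x) ->
  has_rderive w F z d -> has_rderive w G z d.
Proof.
move=> /(@near_rline z w) FG [[FR FRe] [FI FIe]].
split.
- have H : {near (0 : R), (fun t : R => complex.Re (F (z + t%:C * w))) =1
      (fun t : R => complex.Re (G (z + t%:C * w)))}.
    by move: FG; apply: filterS => t /= ->.
  by split; [exact: near_eq_derivable FR|rewrite -(near_eq_derive _ H)].
- have H : {near (0 : R), (fun t : R => complex.Im (F (z + t%:C * w))) =1
      (fun t : R => complex.Im (G (z + t%:C * w)))}.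
    by move: FG; apply: filterS => t /= ->.
  by split; [exact: near_eq_derivable FI|rewrite -(near_eq_derive _ H)].
Qed.

Lemma rderivable_near w F G z : (\forall x \near (z : R[i]^o), F x = G x) ->
  rderivable w F z -> rderivable w G z.
Proof.
by move=> FG /rderivableP /(has_rderive_near _ _ _ _ _ FG) /has_rderive_able.
Qed.

Lemma rderive_near w F G z : (\forall x \near (z : R[i]^o), F x = G x) ->
  rderivable w F z -> rderive w G z = rderive w F z.
Proof. by move=> FG /rderivableP /(has_rderive_near _ _ _ _ _ FG) /has_rderive_val. Qed.

(** Componentwise [1/F] is [(Re F - i Im F) / |F|^2], so the real quotient rules give existence; the
    value of the derivative is found in [has_rderiveV]. *)
Lemma rderivableV w F z : F z != 0 -> rderivable w F z ->
  rderivable w (fun x => (F x)^-1) z.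
Proof.
move=> F0 [dR dI].
have n0 : complex.Re (F z) ^+ 2 + complex.Im (F z) ^+ 2 != 0.
  apply: contra F0; rewrite paddr_eq0 ?sqr_ge0 // !sqrf_eq0.
  by rewrite eq_complex.
pose n2 (x : R[i]) := complex.Re x * complex.Re x + complex.Im x * complex.Im x.
have ReV (x : R[i]) : complex.Re x^-1 = complex.Re x * (n2 x)^-1.
  by case: x.
have ImV (x : R[i]) : complex.Im x^-1 = - (complex.Im x * (n2 x)^-1).
  by case: x.
have dn (f g : R -> R) : f 0 * f 0 + g 0 * g 0 != 0 ->
    derivable f 0 1 -> derivable g 0 1 ->
    derivable (fun t => f t * (f t * f t + g t * g t)^-1) 0 1 /\
    derivable (fun t => - (g t * (f t * f t + g t * g t)^-1)) 0 1.
  move=> fg0 df dg.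
  have dV : derivable (fun t => (f t * f t + g t * g t)^-1) 0 1.
    apply: (@derivableV _ _ (fun t => f t * f t + g t * g t)); first exact: fg0.
    exact: (derivableD (derivableM df df) (derivableM dg dg)).
  by split; [exact: (derivableM df dV)|exact: (derivableN (derivableM dg dV))].
have [|D1 D2] := dn _ _ _ dR dI; first by rewrite !rline0.
split.
- by under [X in derivable X]funext do rewrite ReV; exact: D1.
- by under [X in derivable X]funext do rewrite ImV; exact: D2.
Qed.

(* The principal square root on the right half-plane, and junk elsewhere. *)
Definition csqrt (x : R[i]) : R[i] :=
  let m := Num.sqrt (complex.Re x * complex.Re x + complex.Im x * complex.Im x) in
  let r := Num.sqrt ((m + complex.Re x) / 2) in
  r +i* (complex.Im x / (2 * r)).

Lemma csqrt_Re_gt0 x : 0 < complex.Re x -> 0 < complex.Re (csqrt x).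
Proof.
move=> x0 /=; rewrite sqrtr_gt0 divr_gt0 // ltr_wpDl //.
Qed.

(** With [x = a + ib] and [m = |x|], the root is [r + ib/(2r)] where [r^2 = (m + a)/2]; its square
    is [x] because [b^2 = m^2 - a^2], and [a > 0] keeps [r] away from 0. *)
Lemma csqrtK x : 0 < complex.Re x -> csqrt x * csqrt x = x.
Proof.
move=> x0; have := csqrt_Re_gt0 x x0; rewrite /csqrt /=.
set m := Num.sqrt (_ * _ + _); set r := Num.sqrt _ => r0.
have rr : r * r = (m + complex.Re x) / 2.
  by rewrite -expr2 sqr_sqrtr // divr_ge0 // addr_ge0 ?sqrtr_ge0 // ltW.
have mm : m * m = complex.Re x * complex.Re x + complex.Im x * complex.Im x.
  by rewrite -expr2 sqr_sqrtr // addr_ge0 // -expr2 sqr_ge0.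
clearbody m r; case: x x0 rr mm => a b /= x0 rr mm.
have rn0 : r != 0 by rewrite gt_eqF.
apply/eqP; rewrite eq_complex /=; apply/andP; split; apply/eqP; last by field.
have -> : r * r - b / (2 * r) * (b / (2 * r)) = r * r - b * b / (4 * (r * r)) by field.
have m0 : m + a != 0.
  apply/eqP => ma; move: rr; rewrite ma mul0r => /eqP.
  by rewrite mulf_eq0 orbb (negPf rn0).
rewrite rr; have -> : b * b = m * m - a * a by rewrite mm addrC addKr.
by field.
Qed.

(** Positivity of the real part keeps the arguments of both real square roots in [csqrt] positive,
    where the chain rule applies. *)
Lemma rderivable_csqrt w F z : 0 < complex.Re (F z) -> rderivable w F z ->
  rderivable w (fun x => csqrt (F x)) z.
Proof.
move=> F0 [dR dI].
have ds (f : R -> R) : 0 < f 0 -> derivable f 0 1 ->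
    derivable (fun t => Num.sqrt (f t)) 0 1.
  move=> f0 /derivableP df.
  by have [] := is_derive1_comp (is_derive1_sqrt f0) df.
have d (f g : R -> R) : 0 < f 0 -> derivable f 0 1 -> derivable g 0 1 ->
    let r t := Num.sqrt ((Num.sqrt (f t * f t + g t * g t) + f t) / 2) in
    derivable r 0 1 /\ derivable (fun t => g t / (2 * r t)) 0 1.
  move=> f0 df dg r.
  have dm : derivable (fun t => Num.sqrt (f t * f t + g t * g t)) 0 1.
    apply: ds; first by rewrite ltr_pwDl ?mulr_gt0 // -expr2 sqr_ge0.
    exact: (derivableD (derivableM df df) (derivableM dg dg)).
  have g0 : 0 < (Num.sqrt (f 0 * f 0 + g 0 * g 0) + f 0) / 2.
    by rewrite divr_gt0 // ltr_wpDl // sqrtr_ge0.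
  have dr : derivable r 0 1.
    apply: ds; first exact: g0.
    apply: (derivableM (derivableD dm df)).
    exact: derivable_cst.
  split; first exact: dr.
  apply: (derivableM dg).
  apply: (@derivableV _ _ (fun t => 2 * r t)).
    by rewrite mulf_neq0 // gt_eqF // sqrtr_gt0.
  by apply: (derivableM _ dr); exact: derivable_cst.
have [|D1 D2] := d _ _ _ dR dI; first by rewrite rline0.
exact: conj D1 D2.
Qed.

End Calculus.

(** * Closure properties of smoothness *)

Section Smooth.
Context {R : realType}.
Implicit Types (F G : R[i] -> R[i]) (w z d e : R[i]) (V W : set R[i]^o).

Lemma Ck_continuous {n V F} : Ck n V F ->
  forall z, V z -> {for z, continuous (F : R[i]^o -> R[i]^o)}.
Proof. by case: n => [|n] []. Qed.

Lemma Ck_rderivable {n V F z} : Ck n.+1 V F -> V z ->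
  rderivable 1 F z /\ rderivable 'i F z.
Proof. by move=> [_ [dF _ _]] /dF. Qed.

Lemma CkW n V F : Ck n.+1 V F -> Ck n V F.
Proof.
elim: n F => [|n IHn] F [cF [dF Fx Fy]]; first by split.
split; first exact: cF.
by split; [exact: dF|exact: IHn Fx|exact: IHn Fy].
Qed.

Lemma Ck_subset n V W F : W `<=` V -> Ck n V F -> Ck n W F.
Proof.
move=> WV; elim: n F => [|n IHn] F [cF dF].
  by split; [move=> z Wz; exact: cF z (WV z Wz)|exact: I].
case: dF => dF Fx Fy; split; first by move=> z Wz; exact: cF z (WV z Wz).
by split; [move=> z Wz; exact: dF z (WV z Wz)|exact: IHn Fx|exact: IHn Fy].
Qed.

Lemma near_open {V F G z} : open V -> {in V, F =1 G} -> V z ->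
  \forall x \near (z : R[i]^o), F x = G x.
Proof.
move=> oV FG Vz; have : nbhs (z : R[i]^o) V by exact: open_nbhs_nbhs.
by apply: filterS => x Vx; apply: FG; rewrite inE.
Qed.

Lemma continuous_eq_in V F G : open V -> {in V, F =1 G} ->
  (forall z, V z -> {for z, continuous (F : R[i]^o -> R[i]^o)}) ->
  forall z, V z -> {for z, continuous (G : R[i]^o -> R[i]^o)}.
Proof.
move=> oV FG cF z Vz; rewrite /prop_for /continuous_at -(FG z) ?inE //.
apply: cvg_trans (cF z Vz).
have E : {near z : R[i]^o, (F : R[i]^o -> R[i]^o) =1 G}.
  exact: near_open oV FG Vz.
exact: near_eq_cvg E.
Qed.

(** Openness of [V] turns equality on [V] into equality near each of its points, which is what
    derivatives see. *)
Lemma Ck_eq n V F G : open V -> {in V, F =1 G} -> Ck n V F -> Ck n V G.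
Proof.
move=> oV; elim: n F G => [|n IHn] F G FG [cF dF].
  by split; [exact: continuous_eq_in oV FG cF|exact: I].
case: dF => dF Fx Fy; split; first exact: continuous_eq_in oV FG cF.
have E z : V z -> \forall x \near (z : R[i]^o), F x = G x.
  by move=> Vz; exact: near_open oV FG Vz.
split.
- move=> z Vz; have [d1 di] := dF z Vz.
  by split; [exact: rderivable_near (E z Vz) d1|exact: rderivable_near (E z Vz) di].
- apply: IHn Fx => z; rewrite inE => Vz; have [d1 _] := dF z Vz.
  exact/esym/(rderive_near _ _ _ _ (E z Vz) d1).
- apply: IHn Fy => z; rewrite inE => Vz; have [_ di] := dF z Vz.
  exact/esym/(rderive_near _ _ _ _ (E z Vz) di).
Qed.

(** The partial derivatives may be supplied as explicit formulas [F1] and [F2], so that the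
    regularity of an expression follows by induction from that of the formula for its derivative. *)
Lemma CkS n V F F1 F2 : open V ->
  (forall z, V z -> {for z, continuous (F : R[i]^o -> R[i]^o)}) ->
  (forall z, V z -> has_rderive 1 F z (F1 z)) ->
  (forall z, V z -> has_rderive 'i F z (F2 z)) ->
  Ck n V F1 -> Ck n V F2 -> Ck n.+1 V F.
Proof.
move=> oV cF d1 d2 C1 C2; split; first exact: cF.
split.
- move=> z Vz; split; first exact: has_rderive_able (d1 z Vz).
  exact: has_rderive_able (d2 z Vz).
- by apply: Ck_eq C1 => // z; rewrite inE => Vz; rewrite (has_rderive_val (d1 z Vz)).
- by apply: Ck_eq C2 => // z; rewrite inE => Vz; rewrite (has_rderive_val (d2 z Vz)).
Qed.

Lemma Ck_cst n V (a : R[i]) : open V -> Ck n V (fun=> a).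
Proof.
move=> oV; elim: n a => [|n IHn] a.
  by split; [move=> z _; exact: cst_continuous|exact: I].
apply: (CkS n V _ (fun=> 0) (fun=> 0)); [exact: oV| | | |exact: IHn|exact: IHn].
- by move=> z _; exact: cst_continuous.
- by move=> z _; exact: has_rderive_cst.
- by move=> z _; exact: has_rderive_cst.
Qed.

Lemma Ck_has_rderive {n V F z} : Ck n.+1 V F -> V z ->
  has_rderive 1 F z (rderive 1 F z) /\ has_rderive 'i F z (rderive 'i F z).
Proof. by move=> CF /(Ck_rderivable CF)[/rderivableP ? /rderivableP]. Qed.

Lemma CkD n V F G : open V -> Ck n V F -> Ck n V G -> Ck n V (fun x => F x + G x).
Proof.
move=> oV; elim: n F G => [|n IHn] F G CF CG;
  have cFG z : V z -> {for z, continuous ((fun x => F x + G x) : R[i]^o -> R[i]^o)}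
  by move=> Vz; exact: (cvgD (Ck_continuous CF z Vz) (Ck_continuous CG z Vz)).
  by split; [exact: cFG|exact: I].
apply: (CkS n V _ (fun z => rderive 1 F z + rderive 1 G z)
  (fun z => rderive 'i F z + rderive 'i G z));
  [exact: oV|exact: cFG|move=> z Vz|move=> z Vz| |].
- by apply: has_rderiveD; [case: (Ck_has_rderive CF Vz)|case: (Ck_has_rderive CG Vz)].
- by apply: has_rderiveD; [case: (Ck_has_rderive CF Vz)|case: (Ck_has_rderive CG Vz)].
- by case: CF => _ [_ ? _]; case: CG => _ [_ ? _]; exact: IHn.
- by case: CF => _ [_ _ ?]; case: CG => _ [_ _ ?]; exact: IHn.
Qed.

Lemma CkM n V F G : open V -> Ck n V F -> Ck n V G -> Ck n V (fun x => F x * G x).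
Proof.
move=> oV; elim: n F G => [|n IHn] F G CF CG;
  have cFG z : V z -> {for z, continuous ((fun x => F x * G x) : R[i]^o -> R[i]^o)}
  by move=> Vz; exact: (cvgM (Ck_continuous CF z Vz) (Ck_continuous CG z Vz)).
  by split; [exact: cFG|exact: I].
apply: (CkS n V _ (fun z => rderive 1 F z * G z + F z * rderive 1 G z)
  (fun z => rderive 'i F z * G z + F z * rderive 'i G z));
  [exact: oV|exact: cFG|move=> z Vz|move=> z Vz| |].
- by apply: has_rderiveM; [case: (Ck_has_rderive CF Vz)|case: (Ck_has_rderive CG Vz)].
- by apply: has_rderiveM; [case: (Ck_has_rderive CF Vz)|case: (Ck_has_rderive CG Vz)].
(* The product rule also contains [F] and [G] undifferentiated, hence their regularity at order
   [n]. *)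
- have [CF' CG'] := (CkW _ _ _ CF, CkW _ _ _ CG).
  by case: CF => _ [_ ? _]; case: CG => _ [_ ? _]; apply: (CkD _ _ _ _ oV); exact: IHn.
- have [CF' CG'] := (CkW _ _ _ CF, CkW _ _ _ CG).
  by case: CF => _ [_ _ ?]; case: CG => _ [_ _ ?]; apply: (CkD _ _ _ _ oV); exact: IHn.
Qed.

(** The derivative exists by [rderivableV]; its value is read off by differentiating [F * F^-1 = 1],
    which holds near [z]. The sign is written as a factor -1 so that [CkM] and [Ck_cst] apply to the
    result. *)
Lemma has_rderiveV w F z d : {for z, continuous (F : R[i]^o -> R[i]^o)} ->
  F z != 0 -> has_rderive w F z d ->
  has_rderive w (fun x => (F x)^-1) z (- 1 * (d * ((F z)^-1 * (F z)^-1))).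
Proof.
move=> cF F0 dF; have /rderivableP dV := rderivableV w F z F0 (has_rderive_able dF).
suff -> : - 1 * (d * ((F z)^-1 * (F z)^-1)) = rderive w (fun x => (F x)^-1) z by [].
have F0' : \forall x \near (z : R[i]^o), F x * (F x)^-1 = 1.
  have : \forall x \near (z : R[i]^o), F x != 0.
    exact: cvgr_neq0 cF F0.
  by apply: filterS => x Fx; rewrite mulfV.
have E := has_rderive_near _ _ _ _ _ F0' (has_rderiveM _ _ _ _ _ _ dF dV).
have := has_rderive_val E; rewrite (has_rderive_val (has_rderive_cst w z 1)).
move=> /esym/eqP; rewrite addrC addr_eq0 => /eqP h.
apply: (mulfI F0); rewrite h; field; exact: F0.
Qed.

(** Induction on the order for a fixed [F]: the derivative of [1/F] is built from a derivative of
    [F] and from [1/F] itself, which the induction hypothesis covers. *)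
Lemma CkV n V F : open V -> (forall z, V z -> F z != 0) -> Ck n V F ->
  Ck n V (fun x => (F x)^-1).
Proof.
move=> oV F0; elim: n => [|n IHn] CF;
  have cV z : V z -> {for z, continuous ((fun x => (F x)^-1) : R[i]^o -> R[i]^o)}
  by move=> Vz; exact: (cvgV (F0 z Vz) (Ck_continuous CF z Vz)).
  by split; [exact: cV|exact: I].
have IH := IHn (CkW _ _ _ CF).
apply: (CkS n V _ (fun z => - 1 * (rderive 1 F z * ((F z)^-1 * (F z)^-1)))
  (fun z => - 1 * (rderive 'i F z * ((F z)^-1 * (F z)^-1))));
  [exact: oV|exact: cV|move=> z Vz|move=> z Vz| |].
- apply: has_rderiveV; [exact: Ck_continuous CF z Vz|exact: F0|].
  by case: (Ck_has_rderive CF Vz).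
- apply: has_rderiveV; [exact: Ck_continuous CF z Vz|exact: F0|].
  by case: (Ck_has_rderive CF Vz).
- case: CF => _ [_ ? _]; apply: (CkM _ _ _ _ oV); first exact: Ck_cst.
  by apply: (CkM _ _ _ _ oV) => //; exact: CkM.
- case: CF => _ [_ _ ?]; apply: (CkM _ _ _ _ oV); first exact: Ck_cst.
  by apply: (CkM _ _ _ _ oV) => //; exact: CkM.
Qed.

Lemma Re_le_norm (x : R[i]) : (complex.Re x)%:C <= `|x|.
Proof. by apply: le_trans (normc_ge_Re x); rewrite lecR ler_norm. Qed.

(** The disc of radius [Re z] around [z] stays in the right half-plane. *)
Lemma near_Re_gt0 (z : R[i]) : 0 < complex.Re z ->
  \forall x \near (z : R[i]^o), 0 < complex.Re x.
Proof.
move=> z0.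
have e0 : 0 < (complex.Re z)%:C by rewrite ltcR.
apply: filterS (@nbhsx_ballx _ R[i]^o z _ e0) => x.
rewrite -ball_normE /= => zx.
have := le_lt_trans (Re_le_norm _) zx.
by rewrite ltcR Re_addc; case: (x) => a b /=; rewrite ltrBlDr ltrDl.
Qed.

(** Since [z - x = (csqrt z - csqrt x) * (csqrt z + csqrt x)] and
    [Re (csqrt z) <= |csqrt z + csqrt x|], the roots differ by at most [|z - x| / Re (csqrt z)]. *)
Lemma continuous_csqrt (z : R[i]) : 0 < complex.Re z ->
  {for z, continuous (csqrt : R[i]^o -> R[i]^o)}.
Proof.
move=> z0; apply/(@cvgrPdist_lt _ R[i]^o _ (nbhs (z : R[i]^o))) => e e0.
have r0 := csqrt_Re_gt0 z z0.
have e1 : 0 < e * (complex.Re (csqrt z))%:C by rewrite mulr_gt0 // ltcR.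
have H1 := near_Re_gt0 z z0.
have H2 : \forall x \near (z : R[i]^o), `|z - x| < e * (complex.Re (csqrt z))%:C.
  apply: filterS (@nbhsx_ballx _ R[i]^o z _ e1) => x.
  by rewrite -ball_normE.
apply: (@filterS2 _ (nbhs (z : R[i]^o)) _ _ _ _ _ H1 H2) => x x0 zx.
rewrite -(@ltr_pM2r _ (complex.Re (csqrt z))%:C) ?ltcR //.
apply: le_lt_trans zx.
have -> : z - x = (csqrt z - csqrt x) * (csqrt z + csqrt x).
  by rewrite -{1}(csqrtK z z0) -{1}(csqrtK x x0); ring.
rewrite normrM ler_wpM2l //; apply: le_trans (Re_le_norm _).
by rewrite lecR Re_addc lerDl ltW // csqrt_Re_gt0.
Qed.

(** Once existence is known, differentiating [csqrt F * csqrt F = F], valid near [z], gives the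
    value. *)
Lemma has_rderive_csqrt w F z d : {for z, continuous (F : R[i]^o -> R[i]^o)} ->
  0 < complex.Re (F z) -> has_rderive w F z d ->
  has_rderive w (fun x => csqrt (F x)) z (d * (2 * csqrt (F z))^-1).
Proof.
move=> cF F0 dF.
have /rderivableP dV := rderivable_csqrt w F z F0 (has_rderive_able dF).
suff -> : d * (2 * csqrt (F z))^-1 = rderive w (fun x => csqrt (F x)) z by [].
have F0' : \forall x \near (z : R[i]^o), csqrt (F x) * csqrt (F x) = F x.
  have : \forall x \near (z : R[i]^o), 0 < complex.Re (F x).
    exact: cF _ (near_Re_gt0 _ F0).
  by apply: filterS => x Fx; rewrite csqrtK.
have E := has_rderive_near _ _ _ _ _ F0' (has_rderiveM _ _ _ _ _ _ dV dV).
have s0 : csqrt (F z) != 0.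
  by apply: contraTneq (csqrt_Re_gt0 _ F0) => ->; rewrite /= ltxx.
rewrite -(has_rderive_val dF) (has_rderive_val E).
by field.
Qed.

(** As for [CkV]: the derivative of the root is that of [F] divided by twice the root, to which the
    induction hypothesis applies. *)
Lemma Ck_csqrt n V F : open V -> (forall z, V z -> 0 < complex.Re (F z)) ->
  Ck n V F -> Ck n V (fun x => csqrt (F x)).
Proof.
move=> oV F0; elim: n => [|n IHn] CF;
  have cV z : V z -> {for z, continuous ((fun x => csqrt (F x)) : R[i]^o -> R[i]^o)}
  by move=> Vz; apply: (@continuous_comp _ _ _ (F : R[i]^o -> R[i]^o)
      (csqrt : R[i]^o -> R[i]^o));
    [exact: Ck_continuous CF z Vz|apply: continuous_csqrt; exact: F0].
  by split; [exact: cV|exact: I].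
have IH := IHn (CkW _ _ _ CF).
have CI : Ck n V (fun x => (2 * csqrt (F x))^-1).
  apply: CkV => // [z Vz|]; last by apply: CkM => //; exact: Ck_cst.
  rewrite mulf_neq0 ?pnatr_eq0 //.
  by apply: contraTneq (csqrt_Re_gt0 _ (F0 z Vz)) => ->; rewrite /= ltxx.
apply: (CkS n V _ (fun z => rderive 1 F z * (2 * csqrt (F z))^-1)
  (fun z => rderive 'i F z * (2 * csqrt (F z))^-1));
  [exact: oV|exact: cV|move=> z Vz|move=> z Vz| |].
- apply: has_rderive_csqrt; [exact: Ck_continuous CF z Vz|exact: F0|].
  by case: (Ck_has_rderive CF Vz).
- apply: has_rderive_csqrt; [exact: Ck_continuous CF z Vz|exact: F0|].
  by case: (Ck_has_rderive CF Vz).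
- by case: CF => _ [_ ? _]; exact: (CkM _ _ _ _ oV).
- by case: CF => _ [_ _ ?]; exact: (CkM _ _ _ _ oV).
Qed.

End Smooth.

(** * Smooth functions on the surface *)

Section SmoothFunctions.
Context {R : realType} {M : riemannSurface R}.
Implicit Types (p q : M) (c : chart R M) (U W : set M) (f g : M -> R[i]).

(** Within the open image of the chart, the image of [U] is the preimage of [U] under the continuous
    [coord_inv]. *)
Lemma chart_image_open c U : open U -> open (coord c @` (U `&` chart_dom c)).
Proof.
move=> oU; rewrite openE => z [p [Up cp] <-].
have Ip : (coord c @` chart_dom c) (coord c p) by exists p.
have N1 : nbhs (coord c p) (coord c @` chart_dom c).
  by apply: open_nbhs_nbhs; split=> //; exact: chart_im_open.
have N2 : nbhs (coord c p) (coord_inv c @^-1` U).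
  apply: (coord_inv_continuous Ip); rewrite coordK //.
  exact: open_nbhs_nbhs.
by apply: filterS2 N1 N2 => _ [q cq <-]; rewrite /= coordK // => Uq; exists q.
Qed.

Lemma smooth_fun_subset U W f : W `<=` U -> smooth_fun U f -> smooth_fun W f.
Proof.
move=> WU sf c ac n; apply: Ck_subset (sf c ac n).
by move=> _ [q [Wq cq] <-]; exists q => //; split=> //; exact: WU.
Qed.

Lemma smooth_fun_eq U f g : open U -> (forall q, U q -> f q = g q) ->
  smooth_fun U f -> smooth_fun U g.
Proof.
move=> oU fg sf c ac n; apply: Ck_eq (sf c ac n); first exact: chart_image_open.
by move=> z; rewrite inE => -[q [Uq cq] <-]; rewrite /= coordK // fg.
Qed.

Lemma smooth_fun_cst U (a : R[i]) : open U -> smooth_fun U (fun=> a).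
Proof. by move=> oU c ac n; apply: Ck_cst; exact: chart_image_open. Qed.

Lemma smooth_funM U f g : open U -> smooth_fun U f -> smooth_fun U g ->
  smooth_fun U (fun q => f q * g q).
Proof.
move=> oU sf sg c ac n; have oV := chart_image_open c U oU.
exact: CkM _ _ _ _ oV (sf c ac n) (sg c ac n).
Qed.

Lemma smooth_fun_csqrt U f : open U -> (forall q, U q -> 0 < complex.Re (f q)) ->
  smooth_fun U f -> smooth_fun U (fun q => csqrt (f q)).
Proof.
move=> oU f0 sf c ac n; have oV := chart_image_open c U oU.
apply: Ck_csqrt _ _ _ oV _ (sf c ac n) => z [q [Uq cq] <-].
by rewrite /= coordK //; exact: f0.
Qed.

Lemma smooth_fun_continuous {U f p} : open U -> smooth_fun U f -> U p ->
  {for p, continuous (f : M -> R[i]^o)}.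
Proof.
move=> oU sf Up; have [c [ac cp]] := atlas_cover p.
have Ip : (coord c @` (U `&` chart_dom c)) (coord c p) by exists p.
have cF := Ck_continuous (sf c ac 0) _ Ip.
have cC := Defs.coord_continuous cp.
have E : {near p, ((f \o coord_inv c : R[i]^o -> R[i]^o) \o coord c) =1
    (f : M -> R[i]^o)}.
  have : nbhs p (chart_dom c).
    by apply: open_nbhs_nbhs; split=> //; exact: chart_dom_open.
  by apply: filterS => q cq /=; rewrite coordK.
have cfc := continuous_comp cC cF.
rewrite /prop_for /continuous_at.
have -> : f p = ((f \o coord_inv c : R[i]^o -> R[i]^o) \o coord c) p.
  by rewrite /= coordK.
by apply: cvg_trans cfc; apply: near_eq_cvg; exact: E.
Qed.

(** Dividing [g] by [g p] makes the value at [p] equal to 1, so the principal root of the quotient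
    is smooth near [p]; a fixed root of [g p] restores the factor. *)
Lemma smooth_local_sqrt U g p : open U -> smooth_fun U g -> U p -> g p != 0 ->
  exists W h, [/\ open W, W `<=` U, W p, smooth_fun W h &
    forall q, W q -> h q ^+ 2 = g q].
Proof.
move=> oU sg Up gp0.
pose k q := (g p)^-1 * g q.
have sk : smooth_fun U k by apply: smooth_funM => //; exact: smooth_fun_cst.
pose W := [set q | U q /\ 0 < complex.Re (k q)].
have oW : open W.
  rewrite openE => q [Uq kq].
  have N1 : nbhs q U by exact: open_nbhs_nbhs.
  have N2 : nbhs q (k @^-1` [set x | 0 < complex.Re x]).
    exact: smooth_fun_continuous oU sk Uq _ (near_Re_gt0 _ kq).
  by apply: filterS2 N1 N2.
have WU : W `<=` U by move=> q [].
exists W, (fun q => sqrtc (g p) * csqrt (k q)); split=> //.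
- by split=> //; rewrite /k mulVf //= ltr01.
- apply: smooth_funM => //; first exact: smooth_fun_cst.
  apply: smooth_fun_csqrt => // [q []//|].
  exact: smooth_fun_subset sk.
- move=> q [_ kq]; rewrite exprMn sqr_sqrtc [csqrt _ ^+ 2]expr2 csqrtK //.
  by rewrite /k mulVKf.
Qed.

Lemma chart_atP p : chart_near p (chart_at p).
Proof. exact: (svalP (cid (atlas_cover p))). Qed.

Lemma coord_vector_self c p : chart_near p c -> coord_vector c p c = 1.
Proof.
move=> [ac cp]; rewrite /= asboolT //.
have E : \forall z \near coord c p, transition c c z = id z.
  have Ip : (coord c @` chart_dom c) (coord c p) by exists p.
  have : nbhs (coord c p) (coord c @` chart_dom c).
    by apply: open_nbhs_nbhs; split=> //; exact: chart_im_open.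
  by apply: filterS => _ [q cq <-]; rewrite /transition coordK.
by rewrite (near_eq_derive _ E) derive_id.
Qed.

Lemma tangentZ p (a : R[i]) (w : tangent p) c : (a *: w) c = a * w c.
Proof. by []. Qed.

End SmoothFunctions.

(** * Local square roots of dz *)

Section SquareRoot.
Context {R : realType} {M : riemannSurface R} (S : squareRoot M).
Implicit Types (p q : M) (c : chart R M) (U W : set M) (xi sigma : cosection S).

Lemma frame_smooth_section (E : lineBundle M) (j : frame_index E) :
  smooth_section (frame_dom j) (frame j).
Proof.
move=> l; have [g [sg gE]] := frame_smooth l j.
exists g; split; first by rewrite setIC.
by move=> p jp lp; exact: gE.
Qed.

Lemma squareZ p (a : R[i]) (s : S p) c : square (a *: s) c = a ^+ 2 * square s c.
Proof. by rewrite (square_quadratic S p).1 tangentZ. Qed.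

(** Were it zero, every square at [p] would have component 0, since the frame spans the fiber; but
    by surjectivity the coordinate vector, whose component is 1, is a square. *)
Lemma square_frame_neq0 c p (j : frame_index S) : chart_near p c ->
  frame_dom j p -> square (frame j p) c != 0.
Proof.
move=> cp jp; have [s sE] := square_surjective S (coord_vector c p).
have [a aE] := frame_span jp s.
apply/eqP => e0; have := coord_vector_self c p cp.
by rewrite -sE aE squareZ e0 mulr0 => /esym/eqP; rewrite oner_eq0.
Qed.

Lemma sqrt_dz_exists c p : chart_near p c -> exists U sigma,
  [/\ open U, U p & is_sqrt_dz c U sigma].
Proof.
move=> cp; have [j jp] := frame_cover S p.
have sg : smooth_fun (frame_dom j `&` chart_dom c)
    (fun q => square (frame j q) c).
  have ss := @square_smooth _ _ S _ _ (frame_dom_open j) (frame_smooth_section _ j).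
  exact: ss c cp.1.
have oU : open (frame_dom j `&` chart_dom c).
  by apply: openI; [exact: frame_dom_open|exact: chart_dom_open].
have [||W [h [oW WU Wp sh hE]]] := smooth_local_sqrt _ _ p oU sg.
- by split=> //; case: cp.
- exact: square_frame_neq0.
(* The [xget] extracts the coordinate of [s] in the frame; over [W] it exists and is unique, so the
   default 0 does not enter. *)
pose sigma : cosection S := fun q s => xget 0 [set a | s = a *: frame j q] * h q.
have sigmaE q a : W q -> sigma q (a *: frame j q) = a * h q.
  move=> Wq; rewrite /sigma; congr (_ * _); apply: xget_unique => //= b /eqP.
  rewrite -subr_eq0 -scalerBl scaler_eq0 (negPf (frame_neq0 _)) ?orbF ?subr_eq0.
    by move/eqP.
  by have [] := WU q Wq.
exists W, sigma; split=> //; split.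
- by move=> q /WU[].
- split.
    move=> q Wq a s t; have [jq _] := WU q Wq.
    have [x ->] := frame_span jq s; have [y ->] := frame_span jq t.
    by rewrite scalerA -scalerDl !sigmaE // mulrDl mulrA.
  (* Smoothness is tested against every frame: [frame l] is [f] times [frame j], so [sigma] takes
     the value [f * h] on it. *)
  move=> l; have [f [sf fE]] := frame_smooth j l.
  have oWl : open (W `&` frame_dom l) by apply: openI => //; exact: frame_dom_open.
  apply: (@smooth_fun_eq _ _ _ (fun q => f q * h q)) => //.
    by move=> q [Wq lq]; have [jq _] := WU q Wq; rewrite fE // sigmaE.
  apply: smooth_funM => //.
    by apply: smooth_fun_subset sf => q [Wq lq]; have [jq _] := WU q Wq; split.
  by apply: smooth_fun_subset sh => q [].
- move=> q s Wq; have [jq _] := WU q Wq.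
  have [a ->] := frame_span jq s.
  by rewrite sigmaE // squareZ exprMn hE.
Qed.

(** A local root exists, so the choice made in [sqrt_dz] does not fall back on its default. *)
Lemma sqrt_dzP p : exists U,
  [/\ open U, U p & is_sqrt_dz (chart_at p) U (@sqrt_dz _ _ S p)].
Proof.
have [U [sigma H]] := sqrt_dz_exists _ _ (chart_atP p).
rewrite /sqrt_dz; case: xgetP => [tau _ //|/(_ sigma)[]].
by exists U.
Qed.

End SquareRoot.

(** * Wirtinger derivatives *)

Section Wirtinger.
Context {R : realType}.
Implicit Types (F G : R[i] -> R[i]) (z : R[i]).

Definition rdiff F z : Prop := rderivable 1 F z /\ rderivable 'i F z.

Lemma rdiffP F z : rdiff F z -> has_rderive 1 F z (rderive 1 F z) /\
  has_rderive 'i F z (rderive 'i F z).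
Proof. by move=> [/rderivableP ? /rderivableP]. Qed.

Lemma d_z_near F G z : (\forall x \near (z : R[i]^o), F x = G x) ->
  rdiff F z -> d_z G z = d_z F z.
Proof.
move=> FG [d1 di].
by rewrite /d_z (rderive_near _ _ _ _ FG d1) (rderive_near _ _ _ _ FG di).
Qed.

Lemma rdiff_cst (a : R[i]) z : rdiff (fun=> a) z.
Proof. by split; exact: has_rderive_able (has_rderive_cst _ _ _). Qed.

Lemma rdiffM F G z : rdiff F z -> rdiff G z -> rdiff (fun x => F x * G x) z.
Proof.
move=> /rdiffP[F1 Fi] /rdiffP[G1 Gi].
by split; [exact: has_rderive_able (has_rderiveM _ _ _ _ _ _ F1 G1)|
  exact: has_rderive_able (has_rderiveM _ _ _ _ _ _ Fi Gi)].
Qed.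

Lemma rdiffD F G z : rdiff F z -> rdiff G z -> rdiff (fun x => F x + G x) z.
Proof.
move=> /rdiffP[F1 Fi] /rdiffP[G1 Gi].
by split; [exact: has_rderive_able (has_rderiveD _ _ _ _ _ _ F1 G1)|
  exact: has_rderive_able (has_rderiveD _ _ _ _ _ _ Fi Gi)].
Qed.

Lemma rdiff_conj F z : rdiff F z -> rdiff (fun x => (F x)^*) z.
Proof.
move=> /rdiffP[F1 Fi].
by split; [exact: has_rderive_able (has_rderive_conj _ _ _ _ F1)|
  exact: has_rderive_able (has_rderive_conj _ _ _ _ Fi)].
Qed.

Lemma d_zbar_cst (a : R[i]) z : d_zbar (fun=> a) z = 0.
Proof.
by rewrite /d_zbar !(has_rderive_val (has_rderive_cst _ _ _)) mulr0 addr0 mul0r.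
Qed.

Lemma d_zbarM F G z : rdiff F z -> rdiff G z ->
  d_zbar (fun x => F x * G x) z = d_zbar F z * G z + F z * d_zbar G z.
Proof.
move=> /rdiffP[F1 Fi] /rdiffP[G1 Gi].
rewrite /d_zbar (has_rderive_val (has_rderiveM _ _ _ _ _ _ F1 G1)).
by rewrite (has_rderive_val (has_rderiveM _ _ _ _ _ _ Fi Gi)); ring.
Qed.

Lemma d_zbarD F G z : rdiff F z -> rdiff G z ->
  d_zbar (fun x => F x + G x) z = d_zbar F z + d_zbar G z.
Proof.
move=> /rdiffP[F1 Fi] /rdiffP[G1 Gi].
rewrite /d_zbar (has_rderive_val (has_rderiveD _ _ _ _ _ _ F1 G1)).
by rewrite (has_rderive_val (has_rderiveD _ _ _ _ _ _ Fi Gi)); ring.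
Qed.

Lemma d_zbarZ (k : R[i]) F z : rdiff F z ->
  d_zbar (fun x => k * F x) z = k * d_zbar F z.
Proof.
by move=> dF; rewrite (d_zbarM _ _ _ (rdiff_cst k z) dF) d_zbar_cst mul0r add0r.
Qed.

Lemma d_z_conj F z : rdiff F z -> d_z (fun x => (F x)^*) z = (d_zbar F z)^*.
Proof.
move=> /rdiffP[F1 Fi]; rewrite /d_z /d_zbar -complexiE.
rewrite (has_rderive_val (has_rderive_conj _ _ _ _ F1)).
rewrite (has_rderive_val (has_rderive_conj _ _ _ _ Fi)).
have -> : (2 : R[i])^-1 = (2^-1 : R)%:C by rewrite fmorphV rmorph_nat.
case: (rderive 1 F z) (rderive 'i F z) => [a b] [c d] /=.
by apply/eqP; rewrite eq_complex /=; apply/andP; split; apply/eqP; ring.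
Qed.

End Wirtinger.

(** * Linear forms and the exterior derivative in a coordinate *)

Lemma scalar_scale (K : nzRingType) (E : lmodType K) (f : E -> K) :
  scalar f -> forall a x, f (a *: x) = a * f x.
Proof.
move=> lf a x; have f0 : f 0 = 0.
  have /eqP := lf 1 0 0; rewrite scale1r addr0 mul1r.
  by rewrite -subr_eq0 opprD addrA subrr sub0r oppr_eq0 => /eqP.
by have := lf a x 0; rewrite addr0 => ->; rewrite f0 addr0.
Qed.

Section LocalExpression.
Context {R : realType} {M : riemannSurface R}.
Implicit Types (p q : M) (U : set M).

(* d(f dz) = f_zbar dzbar /\ dz = 2i f_zbar dx /\ dy *)
Lemma ext_deriv_scalar (alpha : one_form M) p (w1 w2 : tangent p) (f : R[i] -> R[i]) :
  let c := chart_at p in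
  (forall q, scalar (alpha q)) ->
  (\forall z \near (coord c p : R[i]^o),
     f z = alpha (coord_inv c z) (coord_vector c (coord_inv c z))) ->
  rdiff f (coord c p) ->
  ext_deriv alpha w1 w2 = 2 * 'i * d_zbar f (coord c p) *
    (complex.Re (w1 c) * complex.Im (w2 c) - complex.Im (w1 c) * complex.Re (w2 c))%:C.
Proof.
move=> c sa fE df; rewrite /ext_deriv -/c; congr (_ * _).
(* By C-linearity the coefficient on [d/dy] is ['i] times the one on [d/dx]. *)
have fE' : \forall z \near (coord c p : R[i]^o), 'i * f z =
    alpha (coord_inv c z) ('i *: coord_vector c (coord_inv c z)).
  apply: filterS fE => z ->.
  by rewrite (scalar_scale _ _ _ (sa _)).
have dif : rdiff (fun z => 'i * f z) (coord c p).
  exact: rdiffM (rdiff_cst _ _) df.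
rewrite (rderive_near _ _ _ _ fE' dif.1) (rderive_near _ _ _ _ fE df.2).
have [f1 _] := rdiffP _ _ df.
rewrite (has_rderive_val (has_rderiveM _ _ _ _ _ _ (has_rderive_cst _ _ _) f1)).
rewrite mul0r add0r /d_zbar.
have ii : 'i * 'i = -1 :> R[i] by rewrite -expr2 sqrCi.
(* With -1 written as ['i * 'i], the equality of ['i f_x - f_y] with [2 'i f_zbar] becomes an
   identity in which ['i] is a free symbol. *)
transitivity ('i * rderive 1 f (coord c p) + ('i * 'i) * rderive 'i f (coord c p)).
  by rewrite ii mulN1r.
by field.
Qed.

End LocalExpression.

(** * Coefficients with respect to a square root of dz *)

Section Coefficient.
Context {R : realType} {M : riemannSurface R} {S : squareRoot M}.
Implicit Types (p q : M) (U : set M) (xi : cosection S).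
Context {c : chart R M} {U : set M} {sigma : cosection S}.
Hypotheses (ac : atlas c) (sdz : is_sqrt_dz c U sigma).

(** A square root of the coordinate vector serves as test vector: [sigma] squared takes there the
    value [dz (d/dz) = 1], so [sigma] does not vanish on it. *)
Lemma sqrt_dz_unit q : U q ->
  exists s : S q, square s = coord_vector c q /\ sigma q s ^+ 2 = 1.
Proof.
move=> Uq; have [UD _ sq] := sdz.
have [s sE] := square_surjective S (coord_vector c q).
exists s; split=> //; rewrite sq // sE coord_vector_self //.
by split=> //; exact: UD.
Qed.

Lemma sqr1_neq0 (x : R[i]) : x ^+ 2 = 1 -> x != 0.
Proof.
move=> x2; apply/eqP => x0; move/eqP: x2.
by rewrite x0 expr0n /= eq_sym oner_eq0.
Qed.

Lemma coefficientE xi q s0 a : sigma q s0 != 0 ->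
  (forall s, xi q s = a * sigma q s) -> coefficient xi sigma q = a.
Proof.
move=> s0n xiE; apply: xget_unique => //= b bE.
by apply: (mulIf s0n); rewrite -bE -xiE.
Qed.

(** The fiber is a line and [sigma] is nonzero on it, so [xi] is a multiple of [sigma], with ratio
    read off at the test vector. Hence the set in [coefficient] is nonempty. *)
Lemma coefficientP xi q : U q -> scalar (xi q) ->
  forall s, xi q s = coefficient xi sigma q * sigma q s.
Proof.
move=> Uq lxi; have [UD [ls _] sq] := sdz.
have [s0 [_ /sqr1_neq0 s00]] := sqrt_dz_unit q Uq.
have [j jq] := frame_cover S q.
have [a0 s0E] := frame_span jq s0.
have xiE s : xi q s = xi q s0 / sigma q s0 * sigma q s.
  have [b ->] := frame_span jq s.
  move: s00; rewrite s0E !(scalar_scale _ _ _ lxi) !(scalar_scale _ _ _ (ls q Uq)).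
  by rewrite mulf_eq0 negb_or => /andP[a00 e0]; field; rewrite a00 e0.
by move=> s; rewrite (coefficientE _ _ _ _ s00 xiE).
Qed.

Lemma coefficient_conj xi q : U q -> scalar (xi q) ->
  coefficient (conj_cosection xi) (conj_cosection sigma) q =
  (coefficient xi sigma q)^*.
Proof.
move=> Uq lxi; have [s0 [_ /sqr1_neq0 s00]] := sqrt_dz_unit q Uq.
have xiE := coefficientP xi q Uq lxi.
apply: xget_unique => /= [s|b bE]; first by rewrite /conj_cosection xiE rmorphM.
have sc0 : (sigma q s0)^* != 0 by rewrite conjc_eq0.
apply: (mulIf sc0); rewrite -[LHS]/(b * conj_cosection sigma q s0) -bE.
by rewrite /conj_cosection xiE rmorphM.
Qed.

(** In a local frame the coefficient is the quotient of the frame components of [xi] and [sigma],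
    both smooth, with nonvanishing denominator. *)
Lemma coefficient_rdiff xi p : open U -> U p -> smooth_section10 setT xi ->
  rdiff (coefficient xi sigma \o coord_inv c) (coord c p).
Proof.
move=> oU Up [lxi sxi]; have [UD [ls ss] sq] := sdz.
have [j jp] := frame_cover S p.
have oW : open (U `&` frame_dom j) by apply: openI => //; exact: frame_dom_open.
pose V := coord c @` ((U `&` frame_dom j) `&` chart_dom c).
have oV : open V by exact: chart_image_open.
have Vp : V (coord c p) by exists p => //; split=> //; exact: UD.
pose X := (fun q => xi q (frame j q)) \o coord_inv c.
pose Y := (fun q => sigma q (frame j q)) \o coord_inv c.
have Y0 z : V z -> Y z != 0.
  move=> [q [[Uq jq] cq] <-]; rewrite /Y /= coordK //.
  have [s0 [_ /sqr1_neq0]] := sqrt_dz_unit q Uq.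
  have [a ->] := frame_span jq s0.
  by rewrite (scalar_scale _ _ _ (ls q Uq)) mulf_eq0 negb_or => /andP[].
have CX : Ck 1 V X.
  apply: Ck_subset (sxi j c ac 1%N) => _ [q [[Uq jq] cq] <-].
  by exists q.
have CY : Ck 1 V Y by exact: (ss j c ac 1%N).
have XY : {in V, (fun z => X z * (Y z)^-1) =1 coefficient xi sigma \o coord_inv c}.
  move=> z; rewrite inE => Vz; have Yz := Y0 z Vz; move: Yz.
  case: Vz => q [[Uq jq] cq] <-; rewrite /X /Y /= coordK // => Yq.
  by rewrite (coefficientP xi q Uq (lxi q I)) mulfK.
have CQ : Ck 1 V (coefficient xi sigma \o coord_inv c).
  exact: Ck_eq oV XY (CkM _ _ _ _ oV CX (CkV _ _ _ oV Y0 CY)).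
exact: Ck_rderivable CQ Vp.
Qed.

End Coefficient.

(** * Integrability and the Dirac equations at a point *)

Section SpinorAtPoint.
Context {R : realType} {M : riemannSurface R} {omega : 'I_3 -> one_form M}
  {S : squareRoot M} {u v : cosection S}.
Hypotheses (homega : weierstrass_representation omega)
  (huv : spinor_representation omega u v).
Variable p : M.
Let c := chart_at p.
Let z0 := coord c p.
Let sigma := @sqrt_dz _ _ S p.
Let a := coefficient u sigma \o coord_inv c.
Let b := coefficient v sigma \o coord_inv c.
Let N := form_norm omega (coord_vector c p).

(** The spinor formulas are evaluated at a square root [s] of the coordinate vector, where
    [sigma q s ^+ 2 = 1]. The factor [-1] prepares the use of [d_zbarZ]. *)
Lemma omega_coord_vector U q : is_sqrt_dz c U sigma -> U q ->
  let A := coefficient u sigma q in let B := coefficient v sigma q in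
  [/\ omega 0 q (coord_vector c q) = A * A + -1 * (B * B),
      omega 1 q (coord_vector c q) = 'i * (A * A + B * B) &
      omega 2 q (coord_vector c q) = 2 * (A * B)].
Proof.
move=> sdz Uq A B; have [ac _] := chart_atP p.
have [[[lu _] [lv _]] _ uvE] := huv.
have [s [sE s1]] := sqrt_dz_unit ac sdz q Uq.
rewrite -sE; have [-> -> ->] := uvE q s.
rewrite (coefficientP ac sdz u q Uq (lu q I)).
rewrite (coefficientP ac sdz v q Uq (lv q I)) -/A -/B.
have k (x y : R[i]) : x = y * sigma q s ^+ 2 -> x = y by rewrite s1 mulr1.
split.
- by apply: k; ring.
- by apply: k; ring.
- by apply: k; ring.
Qed.

Lemma near_sqrt_dz U (P : M -> Prop) : open U -> U p -> (forall q, U q -> P q) ->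
  \forall z \near (z0 : R[i]^o), P (coord_inv c z).
Proof.
move=> oU Up UP; have [ac cp] := chart_atP p.
have Ip : (coord c @` (U `&` chart_dom c)) z0 by exists p.
have : nbhs (z0 : R[i]^o) (coord c @` (U `&` chart_dom c)).
  by apply: open_nbhs_nbhs; split=> //; exact: chart_image_open.
by apply: filterS => _ [q [Uq cq] <-]; rewrite coordK //; exact: UP.
Qed.

Lemma rdiff_ab : rdiff a z0 /\ rdiff b z0.
Proof.
have [[su sv] _ _] := huv; have [ac _] := chart_atP p.
have [U [oU Up sdz]] := sqrt_dzP S p.
by split; exact: (coefficient_rdiff ac sdz).
Qed.

(** This evaluates [dirac01] on a conjugate: near [p] the coefficient is the conjugate of that of
    [xi], and conjugation exchanges the two Wirtinger derivatives. *)
Lemma d_z_coefficient_conj (xi : cosection S) : smooth_section10 setT xi ->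
  d_z (coefficient (conj_cosection xi) (conj_cosection sigma) \o coord_inv c) z0 =
  (d_zbar (coefficient xi sigma \o coord_inv c) z0)^*.
Proof.
move=> sxi; have [ac _] := chart_atP p.
have [U [oU Up sdz]] := sqrt_dzP S p.
have dxi := coefficient_rdiff ac sdz xi p oU Up sxi.
rewrite -(d_z_conj _ _ dxi); apply: d_z_near (rdiff_conj _ _ dxi).
apply: (near_sqrt_dz _ (fun q => (coefficient xi sigma q)^* =
  coefficient (conj_cosection xi) (conj_cosection sigma) q) oU Up) => q Uq.
by rewrite (coefficient_conj ac sdz) //; exact: sxi.1.
Qed.

Lemma ReM2i (x : R[i]) (r : R) :
  complex.Re (2 * 'i%R * x * r%:C) = - (2 * complex.Im x * r).
Proof. by rewrite -complexiE; case: x => x y; rewrite !Re_mulc /=; ring. Qed.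

(** As [d (f dz)] is [2i f_zbar] times the real area form, its real part is [-2 Im f_zbar] times
    that form. *)
Lemma closed_at_point (k : 'I_3) (f : R[i] -> R[i]) :
  (\forall z \near (z0 : R[i]^o),
     f z = omega k (coord_inv c z) (coord_vector c (coord_inv c z))) ->
  rdiff f z0 ->
  (forall w1 w2 : tangent p, complex.Re (ext_deriv (omega k) w1 w2) = 0) <->
  complex.Im (d_zbar f z0) = 0.
Proof.
move=> fE df; have [sw _ _] := homega.
have E w1 w2 := ext_deriv_scalar (omega k) p w1 w2 f (sw k).1 fE df.
split=> [H|H w1 w2]; last first.
  by rewrite E ReM2i H mulr0 mul0r oppr0.
(* On the pair [d/dx], [d/dy] the area form takes the value 1. *)
have := H (coord_vector c p) ('i%C *: coord_vector c p).
rewrite E ReM2i tangentZ !(coord_vector_self _ _ (chart_atP p)) /=.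
rewrite !(mulr0, mulr1, mul0r, mul1r, subr0, add0r, addr0, oppr0).
by move/eqP; rewrite oppr_eq0 mulf_eq0 pnatr_eq0 /= => /eqP.
Qed.

(** The two equations in the coefficients of [u] and [v] are the common form to which
    [dirac_at_point] also reduces. *)
Lemma integrability_at_point :
  (forall (k : 'I_3) (w1 w2 : tangent p),
     complex.Re (ext_deriv (omega k) w1 w2) = 0) <->
  b z0 * d_zbar b z0 = - (a z0 * d_zbar a z0)^* /\
  a z0 * d_zbar b z0 + b z0 * d_zbar a z0 =
    (a z0 * d_zbar b z0 + b z0 * d_zbar a z0)^*.
Proof.
have [da db] := rdiff_ab; have [U [oU Up sdz]] := sqrt_dzP S p.
have daa := rdiffM _ _ _ da da; have dbb := rdiffM _ _ _ db db.
have dab := rdiffM _ _ _ da db.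
have dbb' := rdiffM _ _ _ (rdiff_cst (-1) z0) dbb.
have dm := rdiffD _ _ _ daa dbb'; have dp := rdiffD _ _ _ daa dbb.
have dp' := rdiffM _ _ _ (rdiff_cst 'i%R z0) dp.
have dab' := rdiffM _ _ _ (rdiff_cst 2 z0) dab.
have W := near_sqrt_dz U _ oU Up (fun q => omega_coord_vector U q sdz).
have W0 : \forall z \near (z0 : R[i]^o), a z * a z + -1 * (b z * b z) =
    omega 0 (coord_inv c z) (coord_vector c (coord_inv c z)).
  by apply: filterS W => z [].
have W1 : \forall z \near (z0 : R[i]^o), 'i%R * (a z * a z + b z * b z) =
    omega 1 (coord_inv c z) (coord_vector c (coord_inv c z)).
  by apply: filterS W => z [].
have W2 : \forall z \near (z0 : R[i]^o), 2 * (a z * b z) =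
    omega 2 (coord_inv c z) (coord_vector c (coord_inv c z)).
  by apply: filterS W => z [].
have E0 := closed_at_point 0 _ W0 dm.
have E1 := closed_at_point 1 _ W1 dp'.
have E2 := closed_at_point 2 _ W2 dab'.
rewrite (d_zbarD _ _ _ daa dbb') (d_zbarZ _ _ _ dbb) in E0.
rewrite (d_zbarM _ _ _ da da) (d_zbarM _ _ _ db db) in E0.
rewrite (d_zbarZ _ _ _ dp) (d_zbarD _ _ _ daa dbb) in E1.
rewrite (d_zbarM _ _ _ da da) (d_zbarM _ _ _ db db) in E1.
rewrite (d_zbarZ _ _ _ dab) (d_zbarM _ _ _ da db) in E2.
have E3 : (forall (k : 'I_3) (w1 w2 : tangent p),
    complex.Re (ext_deriv (omega k) w1 w2) = 0) <->
  [/\ forall (w1 w2 : tangent p), complex.Re (ext_deriv (omega 0) w1 w2) = 0,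
      forall (w1 w2 : tangent p), complex.Re (ext_deriv (omega 1) w1 w2) = 0 &
      forall (w1 w2 : tangent p), complex.Re (ext_deriv (omega 2) w1 w2) = 0].
  split=> [H|[H0 H1 H2] k w1 w2]; first by split=> w1 w2; exact: H.
  have : k \in [:: 0; 1; 2] by case: k => [[|[|[|k]]] hk].
  by rewrite !inE => /or3P[] /eqP ->.
move: E0 E1 E2; rewrite -!complexiE.
(* In real and imaginary parts both sides become linear relations between products of the
   coordinates, which [lra] compares. *)
move: (d_zbar a z0) (d_zbar b z0) (a z0) (b z0) => [a1 a2] [b1 b2] [A1 A2] [B1 B2].
rewrite /= => E0 E1 E2.
split=> [/E3[/E0 h0 /E1 h1 /E2 h2]|[/eqP]].
  split; apply/eqP; rewrite eq_complex /=; apply/andP; split; apply/eqP; lra.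
rewrite eq_complex /= => /andP[/eqP h0 /eqP h1] /eqP.
(* Equality of a number with its conjugate means that its imaginary part vanishes; the real parts
   give a tautology. *)
rewrite eq_complex /= => /andP[_ /eqP h2].
by apply/E3; split; [apply/E0|apply/E1|apply/E2]; lra.
Qed.

(** A zero norm would make all [omega k] vanish on the coordinate vector, hence [A^2 - B^2] and
    [A^2 + B^2], and then [u] and [v] would have a common zero at [p]. *)
Lemma form_norm_neq0 : N != 0.
Proof.
have [U [oU Up sdz]] := sqrt_dzP S p; have [ac _] := chart_atP p.
have [w0 w1 _] := omega_coord_vector U p sdz Up.
have [[[lu _] [lv _]] uv0 _] := huv.
rewrite /N /form_norm sqrtC_eq0; apply/eqP => S0.
have oz k : omega k p (coord_vector c p) = 0.
  have := @psumr_eq0P _ _ predT (fun k => `|omega k p (coord_vector c p)| ^+ 2)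
    (fun k _ => exprn_ge0 2 (normr_ge0 _)) S0 k isT.
  by move/eqP; rewrite expf_eq0 /= normr_eq0 => /eqP.
move: w0 w1; rewrite !oz.
set A := coefficient u _ _; set B := coefficient v _ _ => w0 w1.
have AB : A * A + B * B = 0.
  by apply/eqP; move/esym/eqP: w1; rewrite mulf_eq0 (negPf (neq0Ci _)).
have A0 : A = 0.
  have : 2 * (A * A) = 0 by rewrite -[RHS](addr0 0) {1}w0 -AB; ring.
  by move/eqP; rewrite !mulf_eq0 pnatr_eq0 /= orbb => /eqP.
have B0 : B = 0.
  by move/eqP: AB; rewrite A0 mul0r add0r mulf_eq0 orbb => /eqP.
have [s] := uv0 p.
rewrite (coefficientP ac sdz u p Up (lu p I)) (coefficientP ac sdz v p Up (lv p I)).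
by rewrite -/A -/B A0 B0 !mul0r eqxx.
Qed.

(** Both sides of each equation are scalar multiples of one nonzero sesquilinear form,
    [sigma p s * (sigma p t)^* / N], so the equations reduce to equalities of scalars. *)
Lemma dirac_at_point :
  (tensor v (dirac10 omega v) p =
     - tensor (dirac01 omega (conj_cosection u)) (conj_cosection u) p /\
   tensor u (dirac10 omega v) p + tensor v (dirac10 omega u) p =
     tensor (dirac01 omega (conj_cosection v)) (conj_cosection u) p
     + tensor (dirac01 omega (conj_cosection u)) (conj_cosection v) p) <->
  b z0 * d_zbar b z0 = - (a z0 * d_zbar a z0)^* /\
  a z0 * d_zbar b z0 + b z0 * d_zbar a z0 =
    (a z0 * d_zbar b z0 + b z0 * d_zbar a z0)^*.
Proof.
have [U [oU Up sdz]] := sqrt_dzP S p; have [ac cp] := chart_atP p.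
have [[su sv] _ _] := huv.
have [s0 [_ /sqr1_neq0 s00]] := sqrt_dz_unit ac sdz p Up.
have sc0 : (sigma p s0)^* != 0 by rewrite conjc_eq0.
have uE s : u p s = a z0 * sigma p s.
  by rewrite (coefficientP ac sdz u p Up (su.1 p I)) /a /z0 /= coordK.
have vE s : v p s = b z0 * sigma p s.
  by rewrite (coefficientP ac sdz v p Up (sv.1 p I)) /b /z0 /= coordK.
have Du s : dirac10 omega u p s = d_zbar a z0 / N * (sigma p s)^* by [].
have Dv s : dirac10 omega v p s = d_zbar b z0 / N * (sigma p s)^* by [].
have Dub s : dirac01 omega (conj_cosection u) p s = (d_zbar a z0)^* / N * sigma p s.
  by congr (_ / _ * _); exact: d_z_coefficient_conj.
have Dvb s : dirac01 omega (conj_cosection v) p s = (d_zbar b z0)^* / N * sigma p s.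
  by congr (_ / _ * _); exact: d_z_coefficient_conj.
have N0 := form_norm_neq0.
have T1 s t : tensor v (dirac10 omega v) p s t =
    b z0 * d_zbar b z0 * (sigma p s * (sigma p t)^* / N).
  rewrite /tensor vE Dv.
  move: (d_zbar a z0) (d_zbar b z0) (a z0) (b z0) (sigma p s) (sigma p t) N.
  by move=> a' b' a0 b0 x y n; ring.
have T2 s t : (- tensor (dirac01 omega (conj_cosection u)) (conj_cosection u) p) s t =
    - (a z0 * d_zbar a z0)^* * (sigma p s * (sigma p t)^* / N).
  rewrite -[LHS]/(- tensor (dirac01 omega (conj_cosection u)) (conj_cosection u) p s t).
  rewrite /tensor Dub /conj_cosection uE !rmorphM.
  move: (d_zbar a z0) (d_zbar b z0) (a z0) (b z0) (sigma p s) (sigma p t) N.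
  by move=> a' b' a0 b0 x y n; ring.
have T3 s t : (tensor u (dirac10 omega v) p + tensor v (dirac10 omega u) p) s t =
    (a z0 * d_zbar b z0 + b z0 * d_zbar a z0) * (sigma p s * (sigma p t)^* / N).
  rewrite -[LHS]/(tensor u (dirac10 omega v) p s t + tensor v (dirac10 omega u) p s t).
  rewrite /tensor uE vE Du Dv.
  move: (d_zbar a z0) (d_zbar b z0) (a z0) (b z0) (sigma p s) (sigma p t) N.
  by move=> a' b' a0 b0 x y n; ring.
have T4 s t : (tensor (dirac01 omega (conj_cosection v)) (conj_cosection u) p
     + tensor (dirac01 omega (conj_cosection u)) (conj_cosection v) p) s t =
    (a z0 * d_zbar b z0 + b z0 * d_zbar a z0)^* * (sigma p s * (sigma p t)^* / N).
  rewrite -[LHS]/(tensor (dirac01 omega (conj_cosection v)) (conj_cosection u) p s t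
     + tensor (dirac01 omega (conj_cosection u)) (conj_cosection v) p s t).
  rewrite /tensor Dub Dvb /conj_cosection uE vE rmorphD !rmorphM.
  move: (d_zbar a z0) (d_zbar b z0) (a z0) (b z0) (sigma p s) (sigma p t) N.
  by move=> a' b' a0 b0 x y n; ring.
(* The common form is nonzero on the test vector, so the scalars in front of it can be compared. *)
have n0 : sigma p s0 * (sigma p s0)^* / N != 0.
  by rewrite !mulf_neq0 // invr_neq0.
split=> [[e1 e2]|[e1 e2]]; split.
- by apply: (mulIf n0); rewrite -T1 -T2 e1.
- by apply: (mulIf n0); rewrite -T3 -T4 e2.
- by apply: funext => s; apply: funext => t; rewrite T1 T2 e1.
(* The right side of [e2] is the conjugate of its left side, so only the first occurrence is
   rewritten. *)
- by apply: funext => s; apply: funext => t; rewrite T3 T4 {1}e2.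
Qed.

End SpinorAtPoint.

(** * From one point to the whole surface *)

Theorem proposition39 (R : realType) (M : riemannSurface R)
    (omega : 'I_3 -> one_form M) (S : squareRoot M) (u v : cosection S)
    (homega : weierstrass_representation omega)
    (huv : spinor_representation omega u v) :
  let ubar := conj_cosection u in
  let vbar := conj_cosection v in
  (forall (k : 'I_3) (p : M) (w1 w2 : tangent p),
     complex.Re (ext_deriv (omega k) w1 w2) = 0)
  <->
  (forall p : M,
     tensor v (dirac10 omega v) p = - tensor (dirac01 omega ubar) ubar p /\
     tensor u (dirac10 omega v) p + tensor v (dirac10 omega u) p =
       tensor (dirac01 omega vbar) ubar p + tensor (dirac01 omega ubar) vbar p).
Proof.
move=> ubar vbar; split=> [H p|H k p w1 w2].
  have [I _] := integrability_at_point homega huv p.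
  have [_ D] := dirac_at_point huv p.
  by apply/D/I => k; exact: H.
have [_ I] := integrability_at_point homega huv p.
have [D _] := dirac_at_point huv p.
exact: I (D (H p)) k w1 w2.
Qed.
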